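(* Let $\alpha$ be a composition with $n$ parts and $\sigma\in S_n$. Suppose that for some $j\in\{1,\dots,n-1\}$ we have $\alpha_j=\alpha_{j+1}$ and $\{\sigma_j,\sigma_{j+1}\}=\{i,i+1\}$ for some $i$. Then $\mathrm{E}^\sigma_\alpha(\mathbf{x};q,t)$ is symmetric in $x_i$ and $x_{i+1}$.
   Context: Permuted-basement Macdonald polynomials: compositions are $\alpha\in\mathbb{Z}_{\ge0}^n$, permutations in one-line notation $(\sigma_1,\dots,\sigma_n)$. The augmented diagram of shape $\alpha$ has rows $r=1,\dots,n$ top to bottom, columns numbered from $0$; row $r$ consists of basement box $(r,0)$ and boxes $(r,c)$, $1\le c\le\alpha_r$. An augmented filling with basement $\sigma$ is a map $F$ from all boxes to $\{1,\dots,n\}$ with $F(r,0)=\sigma_r$; non-attacking means no two distinct boxes with equal entries lie in the same column, or in columns $c-1$ and $c$ with the box in column $c$ strictly lower than the one in column $c-1$; $\mathrm{NAF}_\sigma(\alpha)$ is the set of these. For non-basement $u=(r,c)$: $d(u)=(r,c-1)$, $\mathrm{leg}(u)=\alpha_r-c$, $\mathrm{arm}(u)=|\{r'>r:c\le\alpha_{r'}\le\alpha_r\}|+|\{r'<r:c-1\le\alpha_{r'}<\alpha_r\}|$; $u$ is a descent if $F(d(u))<F(u)$; $\mathrm{maj}(F)=\sum_{\text{descents}}(\mathrm{leg}(u)+1)$. Type A triple: $a=(r,c-1),b=(r,c),e=(r',c)$, $c\ge1$, $r'>r$, $c\le\alpha_{r'}\le\alpha_r$; type B: $a=(r,c-1),b=(r,c),e=(r',c-1)$,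 $c\ge1$, $r'<r$, $c-1\le\alpha_{r'}<\alpha_r$. Ordering by entries with ties broken $a>e>b$, a triple is an inversion triple if $b<a<e$, $a<e<b$ or $e<b<a$; $\mathrm{coinv}(F)$ counts triples of type A or B that are not inversion triples. With $\mathbf{x}^F=\prod_{u\text{ non-basement}}x_{F(u)}$, $\mathrm{E}^\sigma_\alpha(\mathbf{x};q,t)=\sum_{F\in\mathrm{NAF}_\sigma(\alpha)}\mathbf{x}^Fq^{\mathrm{maj}F}t^{\mathrm{coinv}F}\prod_{u\text{ non-basement},\,F(u)\ne F(d(u))}\frac{1-t}{1-q^{1+\mathrm{leg}(u)}t^{1+\mathrm{arm}(u)}}$. *)

(* Defs.v *)
(* Permuted-basement Macdonald polynomials E^sigma_alpha,
   evaluated at points of an arbitrary field. Conventions (0-indexed):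
   rows r : 'I_n (row r+1 of the paper), entries in 'I_n (entry k <-> k+1),
   variable x_k <-> x (k : 'I_n) (x_{k+1} of the paper). *)
From HB Require Import structures.
From mathcomp Require Import all_boot all_order all_algebra all_fingroup.
Set Implicit Arguments.
Unset Strict Implicit.
Unset Printing Implicit Defensive.
Import GRing.Theory.

Section PermBasement.
Variable n : nat.
Variable alpha : 'I_n -> nat.

Definition maxpart : nat := \max_(r < n) alpha r.
Definition box := ('I_n * 'I_maxpart.+1)%type.
(* a filling assigns an entry to every cell of the n x (maxpart+1) grid;
   only the cells of the augmented diagram matter (see NAF below) *)
Definition filling := {ffun box -> 'I_n}.

(* (r,c) belongs to the augmented diagram (basement c = 0 included) *)
Definition inshape (u : box) : bool := (u.2 <= alpha u.1)%N.

Definition entry (F : filling) (r : 'I_n) (c : nat) : nat := F (r, inord c).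

Definition nonattacking (F : filling) : bool :=
  [forall u : box, forall v : box,
    [&& inshape u, inshape v, u != v & F u == F v] ==>
      ~~ ((u.2 == v.2 :> nat) || ((v.2 == (u.2).+1 :> nat) && (u.1 < v.1)%N))].

(* NAF_sigma(alpha), with the normalisation F(r,c) = r outside the diagram,
   so that these fillings are in bijection with the paper's maps *)
Definition NAF (sigma : 'S_n) (F : filling) : bool :=
  [&& [forall r : 'I_n, F (r, ord0) == sigma r],
      [forall u : box, ~~ inshape u ==> (F u == u.1)] &
      nonattacking F].

Definition leg (r : 'I_n) (c : nat) : nat := alpha r - c.
Definition arm (r : 'I_n) (c : nat) : nat :=
  #|[set r' : 'I_n | [&& (r < r')%N, (c <= alpha r')%N & (alpha r' <= alpha r)%N]]|
  + #|[set r' : 'I_n | [&& (r' < r)%N, (c.-1 <= alpha r')%N & (alpha r' < alpha r)%N]]|.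

Definition descent (F : filling) (r : 'I_n) (c : nat) : bool :=
  (entry F r c.-1 < entry F r c)%N.

Definition maj (F : filling) : nat :=
  \sum_(u : box | [&& (0 < u.2)%N, inshape u & descent F u.1 u.2]) (leg u.1 u.2).+1.

(* entries ordered with ties broken a > e > b: key = (entry, rank) *)
Definition ltk (x y : nat * nat) : bool :=
  (x.1 < y.1)%N || ((x.1 == y.1) && (x.2 < y.2)%N).
Definition inversion (a e b : nat) : bool :=
  let ka := (a, 2%N) in let ke := (e, 1%N) in let kb := (b, 0%N) in
  [|| ltk kb ka && ltk ka ke, ltk ka ke && ltk ke kb | ltk ke kb && ltk kb ka].

Definition typeA (r r' : 'I_n) (c : nat) : bool :=
  [&& (0 < c)%N, (r < r')%N, (c <= alpha r')%N & (alpha r' <= alpha r)%N].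
Definition typeB (r r' : 'I_n) (c : nat) : bool :=
  [&& (0 < c)%N, (r' < r)%N, (c.-1 <= alpha r')%N & (alpha r' < alpha r)%N].

Definition coinv (F : filling) : nat :=
  \sum_(r : 'I_n) \sum_(r' : 'I_n) \sum_(c < maxpart.+1)
    ((typeA r r' c && ~~ inversion (entry F r c.-1) (entry F r' c) (entry F r c))
     + (typeB r r' c && ~~ inversion (entry F r c.-1) (entry F r' c.-1) (entry F r c)))%N.

Local Open Scope ring_scope.
Variable R : fieldType.

Definition Eperm (sigma : 'S_n) (x : 'I_n -> R) (q t : R) : R :=
  \sum_(F : filling | NAF sigma F)
    ((\prod_(u : box | (0 < u.2)%N && inshape u) x (F u))
     * q ^+ maj F * t ^+ coinv F
     * \prod_(u : box | [&& (0 < u.2)%N, inshape u & F u != F (u.1, inord (u.2).-1)])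
         ((1 - t) / (1 - q ^+ (leg u.1 u.2).+1 * t ^+ (arm u.1 u.2).+1))).

End PermBasement.

(* Main.v *)
Require Import Defs.
From mathcomp Require Import all_boot all_order all_algebra all_fingroup.
From mathcomp Require Import ring zify.
Set Implicit Arguments.
Unset Strict Implicit.
Unset Printing Implicit Defensive.
Import GRing.Theory.
Local Open Scope ring_scope.

(** Multiplying E by all the denominators gives a polynomial, [Enum]. For a
triple (a, b, e), the bracket [not an inversion] is [e <= a] + [a < b] + [b <= e] - 1,
so the exponent of t is a sum over pairs of boxes in the same column or in
adjacent columns. Hence, up to powers of t that depend only on the shape and on
the basement, [Enum] is an iterated sum over columns ([tail]), with a transfer
weight that is a product over pairs of boxes and vanishes on attacking pairs.

(1) If alpha_j = alpha_(j+1), then [tail] does not change when the entries of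
rows j and j+1 of its first column are exchanged.
(2) Exchanging the entries i and i+1 of a column acts on [tail] as a
Demazure-Lusztig operator: if p and p' are the values before and after, where i
is the upper label before, then t p + p' and x_i p + x_(i+1) p' are symmetric in
x_i and x_(i+1). This passes from a column to the preceding one.

In the basement the two exchanges coincide, so p = p' and (t + 1) p is
symmetric. Replacing t by t + 'X makes t and t + 1 regular; then put 'X = 0. *)

(** * Weights of pairs of entries *)

Section PairWeights.
Variables (A : comNzRingType) (t : A).

(* Both weights are used in place of powers of t and q: [invw] vanishes on an
   attacking pair, and [stepw] is cleared of the denominator 1 - z t. *)
Definition invw (a b : nat) : A := if a == b then 0 else t ^+ (a < b)%N.
Definition stepw (z : A) (a b : nat) : A :=
  if a == b then 1 - z * t else (1 - t) * z ^+ (a < b)%N.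

(** Two rows of equal length have entries [x], [y] in one column and [u], [v] in the next; the arm
    of the upper row is larger by one, whence [z * t] and [z]. Only the sum over both orders of [u]
    and [v] survives the exchange of [x] and [y]; it is checked for every relative order of the four
    entries. *)
Lemma two_row_exchange (z : A) (x y u v : nat) : x != y -> u != v ->
  stepw (z * t) x u * stepw z y v * invw v x * invw u v
  + stepw (z * t) x v * stepw z y u * invw u x * invw v u
  = stepw (z * t) y u * stepw z x v * invw v y * invw u v
  + stepw (z * t) y v * stepw z x u * invw u y * invw v u.
Proof.
move=> xy uv; rewrite /stepw /invw.
case: (ltngtP x y) xy => // xy _; case: (ltngtP u v) uv => // uv _;
case: (ltngtP x u) => xu; case: (ltngtP x v) => xv; try lia;
case: (ltngtP y u) => yu; case: (ltngtP y v) => yv; try lia; rewrite /= ?expr1 ?expr0; ring.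
Qed.
End PairWeights.

(** * Transfer weights and exchange of two rows of equal length *)

(** Isolates the factors that an exchange can change. The block is first given by the two rows,
    later by the boxes carrying the two labels. *)
Lemma prod2_setID (A : comNzRingType) (I : finType) (P Q : pred I)
    (S S' : {set I}) (F : I -> I -> A) :
  {subset S <= P} -> {subset S' <= Q} ->
  \prod_(u | P u) \prod_(v | Q v) F u v =
  (\prod_(u | P u) \prod_(v | Q v && ~~ ((u \in S) && (v \in S'))) F u v)
  * \prod_(u in S) \prod_(v in S') F u v.
Proof.
move=> SP SQ; rewrite !pair_big_dep /= mulrC.
rewrite (bigID (fun p : I * I => (p.1 \in S) && (p.2 \in S'))) /=; congr (_ * _).
  apply: eq_bigl => -[u v] /=.
  case uS: (u \in S); case vS: (v \in S'); rewrite ?andbF ?andbT //=.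
  by rewrite (SP u uS : P u) (SQ v vS : Q v).
by apply: eq_bigl => -[u v] /=; rewrite andbA.
Qed.

Lemma mem_tperm (T : finType) (a b k : T) :
  (tperm a b k \in [set a; b]) = (k \in [set a; b]).
Proof.
by rewrite !inE; case: tpermP => [->|->|/eqP /negPf -> /eqP /negPf ->];
  rewrite ?eqxx ?orbT.
Qed.

Section Transfer.
Variables (A : comNzRingType) (n : nat) (alpha : 'I_n -> nat) (q t : A).
Notation column := {ffun 'I_n -> 'I_n}.

Definition in_row (c : nat) (r : 'I_n) : bool := (c <= alpha r)%N.

(** One factor [t] short of the monomial in the denominator: a descent contributes $q^{leg+1}$
    through maj and $t^{arm}$ through the brackets [a < b] of its triples. [stepw] supplies the
    missing [t] in $1 - zt$. *)
Definition boxz (c : nat) (r : 'I_n) : A :=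
  q ^+ (leg alpha r c).+1 * t ^+ arm alpha r c.

(* [c] is the column of [u], and [v] lies in column [c.+1]; only a strictly lower
   [v] can attack [u] or interact with it through a triple. *)
Definition pairw (c : nat) (u v : 'I_n) (a b : nat) : A :=
  if (u < v)%N then invw t b a
  else if u == v then stepw t (boxz c.+1 u) a b else 1.

Definition inter (c : nat) (s s' : column) : A :=
  \prod_(u | in_row c u) \prod_(v | in_row c.+1 v) pairw c u v (s u) (s' v).

Definition inner (c : nat) (s : column) : A :=
  \prod_(u | in_row c u) \prod_(v | in_row c v)
    (if (u < v)%N then invw t (s u) (s v) else 1).

(** The convention of [NAF] outside the diagram, so that a sum over all columns counts each choice
    of entries inside the diagram once. *)
Definition normalized (c : nat) (s : column) : bool :=
  [forall v, ~~ in_row c v ==> (s v == v)].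

Definition transw (c : nat) (s s' : column) : A :=
  (normalized c.+1 s')%:R * inter c s s' * inner c.+1 s'.

Definition colx (x : 'I_n -> A) (c : nat) (s : column) : A :=
  \prod_(v | in_row c v) x (s v).

(** Total weight of the [k] columns after column [c], whose entries [s] are given. *)
Fixpoint tail (x : 'I_n -> A) (k c : nat) (s : column) : A :=
  if k is k'.+1 then
    \sum_(s' : column) transw c s s' * colx x c.+1 s' * tail x k' c.+1 s'
  else 1.

Lemma inner_eq0 c (s : column) u v : in_row c u -> in_row c v ->
  u != v -> s u = s v -> inner c s = 0.
Proof.
move=> cu cv uv suv.
wlog ltuv : u v cu cv uv suv / (u < v)%N.
  move=> H; case: (ltngtP u v) => [|vu|/val_inj e]; first exact: H.
    by apply: (H v u) => //; rewrite eq_sym.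
  by rewrite e eqxx in uv.
rewrite /inner (bigD1 u) //= (bigD1 v) //= ltuv suv /invw eqxx.
by rewrite !mul0r.
Qed.

Section Swap.
Variables (j j1 : 'I_n).
Hypotheses (Hj1 : val j1 = (val j).+1) (Halpha : alpha j = alpha j1).
Local Notation rho := (tperm j j1).
Local Notation J := [set j; j1].

Definition swap_rows (s : column) : column := [ffun r => s (rho r)].

Lemma swap_rowsK : involutive swap_rows.
Proof. by move=> s; apply/ffunP => r; rewrite !ffunE tpermK. Qed.

Lemma in_row_rho c r : in_row c (rho r) = in_row c r.
Proof. by rewrite /in_row; case: tpermP => // ->; rewrite Halpha. Qed.

Lemma jj1 : (j < j1)%N. Proof. by rewrite Hj1. Qed.

(** [j] and [j1] are consecutive, so every other row lies on the same side of both. *)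
Lemma ltn_rho u v : ~~ ((u \in J) && (v \in J)) -> (rho u < v)%N = (u < v)%N.
Proof.
rewrite !inE negb_and; case: tpermP => // ->; rewrite eqxx ?orbT /= => /norP[/eqP a /eqP b].
all: have a' : val v <> val j by move/val_inj.
all: have b' : val v <> val j1 by move/val_inj.
all: move: Hj1 a' b' => /=; lia.
Qed.

Lemma ltn_rhor u v : ~~ ((u \in J) && (v \in J)) -> (u < rho v)%N = (u < v)%N.
Proof.
rewrite !inE negb_and; case: tpermP => // ->; rewrite eqxx ?orbT /= orbF => /norP[/eqP a /eqP b].
all: have a' : val u <> val j by move/val_inj.
all: have b' : val u <> val j1 by move/val_inj.
all: move: Hj1 a' b' => /=; lia.
Qed.

Lemma pairw_rho c u v a b : ~~ ((u \in J) && (v \in J)) ->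
  pairw c (rho u) v a b = pairw c u v a b.
Proof.
move=> uv; rewrite /pairw ltn_rho //.
case uJ: (u \in J); last first.
  by move/negbT: uJ; rewrite !inE negb_or => /andP[ju j1u]; rewrite tpermD // eq_sym.
have vJ : v \notin J by move: uv; rewrite uJ.
have -> : (u == v) = false by apply: contraNF vJ => /eqP <-.
by have -> : (rho u == v) = false by apply: contraNF vJ => /eqP <-; rewrite mem_tperm.
Qed.

Lemma pairw_rhor c u v a b : ~~ ((u \in J) && (v \in J)) ->
  pairw c u (rho v) a b = pairw c u v a b.
Proof.
move=> uv; rewrite /pairw ltn_rhor //.
case vJ: (v \in J); last first.
  by move/negbT: vJ; rewrite !inE negb_or => /andP[ju j1u]; rewrite tpermD // eq_sym.
have uJ : u \notin J by move: uv; rewrite vJ andbT.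
have -> : (u == v) = false by apply: contraNF uJ => /eqP ->.
by have -> : (u == rho v) = false by apply: contraNF uJ => /eqP ->; rewrite mem_tperm.
Qed.

Definition inter_off c (s s' : column) : A :=
  \prod_(u | in_row c u) \prod_(v | in_row c.+1 v && ~~ ((u \in J) && (v \in J)))
    pairw c u v (s u) (s' v).

Lemma inter_off_swapl c s s' : inter_off c (swap_rows s) s' = inter_off c s s'.
Proof.
rewrite /inter_off (reindex_inj (@perm_inj _ rho)) /=.
apply: eq_big => [u|u _]; first by rewrite in_row_rho.
apply: eq_big => [v|v /andP[_]]; first by rewrite mem_tperm.
by rewrite mem_tperm => uv; rewrite pairw_rho // ffunE tpermK.
Qed.

Lemma inter_off_swapr c s s' : inter_off c s (swap_rows s') = inter_off c s s'.
Proof.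
apply: eq_bigr => u _; rewrite (reindex_inj (@perm_inj _ rho)) /=.
apply: eq_big => [v|v /andP[_]]; first by rewrite in_row_rho mem_tperm.
by rewrite mem_tperm => uv; rewrite pairw_rhor // ffunE tpermK.
Qed.

Definition inner_off c (s : column) : A :=
  \prod_(u | in_row c u) \prod_(v | in_row c v && ~~ ((u \in J) && (v \in J)))
    (if (u < v)%N then invw t (s u) (s v) else 1).

Lemma inner_off_swap c s : inner_off c (swap_rows s) = inner_off c s.
Proof.
rewrite /inner_off (reindex_inj (@perm_inj _ rho)) /=.
apply: eq_big => [u|u _]; first by rewrite in_row_rho.
rewrite (reindex_inj (@perm_inj _ rho)) /=.
apply: eq_big => [v|v /andP[_]]; first by rewrite in_row_rho !mem_tperm.
rewrite !mem_tperm => uv.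
by rewrite ltn_rho ?mem_tperm // ltn_rhor // !ffunE !tpermK.
Qed.

Lemma subset_J c : in_row c j -> {subset J <= in_row c}.
Proof.
by move=> cj r /set2P[] -> //; rewrite unfold_in /in_row -Halpha.
Qed.

Lemma prodJ (f : 'I_n -> A) : \prod_(u in J) f u = f j * f j1.
Proof. by rewrite big_setU1 ?big_set1 // inE neq_ltn jj1. Qed.

(** In the block of the two rows the pair ([j1], [j]) has weight 1, since its box in the later
    column is the higher one; two steps and one crossing remain. *)
Lemma interE c s s' : in_row c.+1 j ->
  inter c s s' = inter_off c s s'
    * (stepw t (boxz c.+1 j) (s j) (s' j) * invw t (s' j1) (s j)
       * stepw t (boxz c.+1 j1) (s j1) (s' j1)).
Proof.
move=> cj; rewrite /inter (@prod2_setID _ _ _ _ J J); last 2 first.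
- by apply: subset_J; apply: leq_trans cj.
- exact: subset_J.
congr (_ * _); rewrite prodJ !prodJ /pairw jj1 !ltnn !eqxx.
have -> : (j1 < j)%N = false by rewrite ltnNge ltnW // jj1.
have -> : (j1 == j) = false by rewrite -val_eqE gtn_eqF // jj1.
by rewrite mul1r.
Qed.

Lemma innerE c s : in_row c j ->
  inner c s = inner_off c s * invw t (s j) (s j1).
Proof.
move=> cj; rewrite /inner (@prod2_setID _ _ _ _ J J); try exact: subset_J.
congr (_ * _); rewrite prodJ !prodJ jj1 !ltnn.
have -> : (j1 < j)%N = false by rewrite ltnNge ltnW // jj1.
by rewrite !mul1r mulr1.
Qed.

Lemma normalized_swap c s : in_row c j -> normalized c (swap_rows s) = normalized c s.
Proof.
move=> cj; apply: eq_forallb => v; case cv: (in_row c v) => //=.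
rewrite ffunE tpermD //; apply: contraFneq cv => <- //.
by rewrite -[j1](tpermL j) in_row_rho.
Qed.

Lemma colx_swap x c s : colx x c (swap_rows s) = colx x c s.
Proof.
rewrite /colx (reindex_inj (@perm_inj _ rho)) /=.
by apply: eq_big => [u|u _]; rewrite ?in_row_rho // ffunE tpermK.
Qed.

Lemma leg_swap c : leg alpha j c = leg alpha j1 c.
Proof. by rewrite /leg Halpha. Qed.

(** Row [j1] counts for the arm of [j], which admits lower rows of equal length; row [j] does not
    count for [j1], since upper rows must be strictly shorter. All other rows count alike. *)
Lemma arm_swap c : in_row c j -> arm alpha j c = (arm alpha j1 c).+1.
Proof.
move=> cj; rewrite /arm -addSn; congr (_ + _)%N.
  rewrite (cardsD1 j1) inE jj1 -Halpha leqnn andbT (cj : _ <= _)%N /= add1n; congr _.+1.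
  apply: eq_card => r; rewrite !inE Halpha; case: eqVneq => [->|]; rewrite ?ltnn //=.
  by rewrite -val_eqE /=; move: Hj1 => /= -> nr; rewrite [in RHS]ltn_neqAle eq_sym nr.
apply: eq_card => r; rewrite !inE Halpha.
case: (eqVneq r j) => [->|]; first by rewrite Halpha !ltnn !andbF.
by rewrite -val_eqE /=; move: Hj1 => /= -> nr; rewrite ltnS [in RHS]leq_eqVlt (negPf nr).
Qed.

Lemma boxz_swap c : in_row c j -> boxz c j = boxz c j1 * t.
Proof. by move=> cj; rewrite /boxz leg_swap arm_swap // [t ^+ _.+1]exprSr mulrA. Qed.

(** The factors outside the block of the two rows agree in all four terms; on the block this is
    [two_row_exchange]. *)
Lemma transw_swap c (s s' : column) : in_row c.+1 j -> s j != s j1 -> s' j != s' j1 ->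
  transw c (swap_rows s) s' + transw c (swap_rows s) (swap_rows s')
  = transw c s s' + transw c s (swap_rows s').
Proof.
move=> cj sj s'j; rewrite /transw !normalized_swap // !interE // !innerE //.
rewrite !inter_off_swapl !inter_off_swapr !inner_off_swap !ffunE !tpermL !tpermR.
rewrite !boxz_swap //.
have := two_row_exchange t (boxz c.+1 j1) sj s'j.
set N := _%:R; set O := inter_off _ _ _; set M := inner_off _ _ => H.
have E (a b : A) : a = b -> N * O * M * a = N * O * M * b by move=> ->.
by move/E: H; rewrite !mulrDr => H; apply: etrans (etrans (esym H) _); ring.
Qed.

Lemma transw_eq0 c (s s' : column) : in_row c.+1 j -> s' j = s' j1 -> transw c s s' = 0.
Proof.
by move=> cj s'j; rewrite /transw innerE // /invw s'j eqxx !mulr0.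
Qed.

(** Column [c.+1] has no box in rows [j] and [j1], so each of its boxes lies above both rows or
    below both. *)
Lemma transw_swap_out c s s' : ~~ in_row c.+1 j ->
  transw c (swap_rows s) s' = transw c s s'.
Proof.
move=> cj; rewrite /transw; congr (_ * _ * _).
have E s0 : inter c s0 s' = inter_off c s0 s'.
  apply: eq_bigr => u _; apply: eq_bigl => v.
  case cv: (in_row c.+1 v) => //=; suff /negPf -> : v \notin J by rewrite andbF.
  apply: contra cj; rewrite !inE => /orP[]/eqP e; rewrite -?e //.
  by rewrite -in_row_rho tpermL -e.
by rewrite !E inter_off_swapl.
Qed.

(** While both rows continue, the next columns are taken in pairs [s'], [swap_rows s'], which by
    induction have a common tail to factor out. Once the rows have ended, the transfer weight itself
    is unchanged. *)
Lemma tail_swap x k c (s : column) : in_row c j -> s j != s j1 ->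
  tail x k c (swap_rows s) = tail x k c s.
Proof.
elim: k c s => [|k IH] c s //= cj sj.
case cSj: (in_row c.+1 j); last first.
  by apply: eq_bigr => s' _; rewrite transw_swap_out ?cSj.
(* Columns with equal entries in the two rows have weight zero; each pair of the others is
   represented by its member with [s' j < s' j1]. *)
have split_sum (f : column -> A) : (forall s' : column, s' j = s' j1 -> f s' = 0) ->
    \sum_s' f s' = \sum_(s' : column | (s' j < s' j1)%N) (f s' + f (swap_rows s')).
  move=> f0; rewrite big_split /= (bigID (fun s' : column => (s' j < s' j1)%N)) /=.
  congr (_ + _); rewrite (bigID (fun s' : column => s' j == s' j1)) /=.
  rewrite big1 ?add0r; last by move=> s' /andP[_ /eqP /f0].
  rewrite [RHS](reindex_inj (inv_inj swap_rowsK)) /=.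
  apply: eq_big => s' ; last by rewrite swap_rowsK.
  by rewrite !ffunE tpermL tpermR -leqNgt [in RHS]ltn_neqAle andbC eq_sym.
rewrite !split_sum; try by move=> s' e; rewrite transw_eq0 // !mul0r.
apply: eq_bigr => s' lt; have s'j : s' j != s' j1 by rewrite neq_ltn lt.
rewrite !colx_swap !IH // -!mulrDl; congr (_ * _ * _); exact: transw_swap.
Qed.

End Swap.
End Transfer.

(** * Exchange of two consecutive labels *)

Section HeckeRelation.
Variables (A : comNzRingType) (t x1 x2 : A).

(* [r], [r'] stand for [p], [p'] with [x1] and [x2] exchanged. *)
Definition hrel (p p' r r' : A) : Prop :=
  t * p + p' = t * r + r' /\ x1 * p + x2 * p' = x2 * r + x1 * r'.

Lemma hrel_sym p r : p = r -> hrel p p r r.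
Proof. by move=> ->; split=> //; rewrite addrC. Qed.

Lemma hrelD p p' r r' o o' e e' : hrel p p' r r' -> hrel o o' e e' ->
  hrel (p + o) (p' + o') (r + e) (r' + e').
Proof.
case=> a b [c d]; split.
  by rewrite !mulrDr addrACA a c addrACA.
by rewrite !mulrDr addrACA b d addrACA.
Qed.

Lemma hrelZ C p p' r r' : hrel p p' r r' -> hrel (C * p) (C * p') (C * r) (C * r').
Proof.
case=> a b; split.
  by rewrite !(mulrCA _ C) -!mulrDr a.
by rewrite !(mulrCA _ C) -!mulrDr b.
Qed.

Lemma hrel_sum (I : finType) (P : pred I) (f f' g g' : I -> A) :
  (forall k, P k -> hrel (f k) (f' k) (g k) (g' k)) ->
  hrel (\sum_(k | P k) f k) (\sum_(k | P k) f' k)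
       (\sum_(k | P k) g k) (\sum_(k | P k) g' k).
Proof.
move=> H; split; rewrite !mulr_sumr -!big_split /=;
  by apply: eq_bigr => k /H[].
Qed.

(** For a next column with exactly one of the two labels; [m11] to [m22] are the transfer weights, 1
    standing for the given labels and 2 for the exchanged ones. The new $tp+p'$ is a multiple of the
    old $x_1p+x_2p'$, and the new $x_1p+x_2p'$ combines both old forms with coefficients symmetric
    in [x1], [x2]. *)
Lemma hrel_single (m11 m12 m21 m22 p p' r r' : A) :
  m11 = m22 -> m21 = t * m12 + (1 - t) * m11 -> hrel p p' r r' ->
  hrel (m11 * (x1 * p) + m12 * (x2 * p')) (m21 * (x1 * p) + m22 * (x2 * p'))
       (m11 * (x2 * r) + m12 * (x1 * r')) (m21 * (x2 * r) + m22 * (x1 * r')).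
Proof.
move=> <- -> [a b]; split.
  transitivity ((m11 + t * m12) * (x1 * p + x2 * p')); first by ring.
  by rewrite b; ring.
transitivity (m11 * ((x1 + x2) * (x1 * p + x2 * p') - x1 * x2 * (t * p + p'))
   + m12 * (x1 * x2) * (t * p + p')); first by ring.
by rewrite a b; ring.
Qed.

(** For a next column with both labels, its monomial [x1 * x2] being factored out. Again the new
    forms combine the old ones with symmetric coefficients. *)
Lemma hrel_double (m11 m12 m21 m22 p p' r r' : A) :
  m21 = t * m12 -> m22 = m11 + (1 - t) * m12 -> hrel p p' r r' ->
  hrel (m11 * p + m12 * p') (m21 * p + m22 * p')
       (m11 * r + m12 * r') (m21 * r + m22 * r').
Proof.
move=> -> -> [a b]; split.
  transitivity ((m11 + m12) * (t * p + p')); first by ring.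
  by rewrite a; ring.
transitivity (m12 * (x1 + x2) * (t * p + p')
   + (m11 - t * m12) * (x1 * p + x2 * p')); first by ring.
by rewrite a b; ring.
Qed.

(** The hypotheses of [hrel_double] when both columns hold both labels. The letters in [wab], [mab]
    are the row in the given column, then the row in the next; [w] stands for equal labels, [m] for
    [i] followed by [i1], and [h] for [i1] followed by [i]. *)
Lemma hecke_double_entries (waa wab wba wbb maa mab mba mbb : A) :
  waa = 0 \/ wba = mba -> wab = 0 \/ wbb = mbb ->
  wab = 0 \/ waa = maa -> wbb = 0 \/ wba = mba ->
  let h m w := t * m + (1 - t) * w in
  h maa waa * wab * (wba * mbb) * t = t * (maa * wab * (wba * h mbb wbb))
  /\ waa * h mab wab * (mba * wbb)
    = waa * mab * (h mba wba * wbb) * t + (1 - t) * (maa * wab * (wba * h mbb wbb)).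
Proof.
by move=> H1 H2 H3 H4 /=; case: H1 => ?; case: H2 => ?; case: H3 => ?; case: H4 => ?;
  subst; split; ring.
Qed.
End HeckeRelation.

(** * Relabelled columns and the Hecke relation for [tail] *)

Section Relabel.
Variables (A : comNzRingType) (n : nat) (alpha : 'I_n -> nat) (q t : A).
Notation column := {ffun 'I_n -> 'I_n}.
Variables (i i1 : 'I_n).
Hypothesis (Hi1 : val i1 = (val i).+1).
Local Notation tau := (tperm i i1).
Local Notation pair := [set i; i1].
Local Notation inrow := (in_row alpha).
Local Notation pairw := (pairw alpha q t).
Local Notation inter := (inter alpha q t).
Local Notation inner := (inner alpha t).
Local Notation normalized := (normalized alpha).
Local Notation colx := (colx alpha).
Local Notation tail := (tail alpha q t).

(** Entries outside the diagram stay fixed, so that [normalized] is preserved. *)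
Definition relabel c (s : column) : column :=
  [ffun r => if inrow c r then tau (s r) else s r].

Definition lab c (s : column) : {set 'I_n} := [set r | inrow c r && (s r \in pair)].

Lemma relabelK c : involutive (relabel c).
Proof. by move=> s; apply/ffunP => r; rewrite !ffunE; case cr: (inrow c r); rewrite ?tpermK. Qed.

Lemma relabel_in c s r : inrow c r -> relabel c s r = tau (s r).
Proof. by rewrite ffunE => ->. Qed.

Lemma tau_id k : k \notin pair -> tau k = k.
Proof. by rewrite !inE negb_or => /andP[a b]; rewrite tpermD // eq_sym. Qed.

Lemma lab_relabel c s : lab c (relabel c s) = lab c s.
Proof. by apply/setP => r; rewrite !inE ffunE; case: ifP => //=; rewrite -!in_set2 mem_tperm. Qed.

Lemma lab_inrow c s : {subset lab c s <= inrow c}.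
Proof. by move=> r; rewrite inE => /andP[]. Qed.

Lemma lab_notin c s r : inrow c r -> r \notin lab c s -> s r \notin pair.
Proof. by rewrite inE => ->. Qed.

Lemma relabel_notin c s r : r \notin lab c s -> relabel c s r = s r.
Proof.
by rewrite inE ffunE; case: ifP => //= _; apply: tau_id.
Qed.

(** No label lies strictly between [i] and [i1], so a third label compares in the same way with
    both. *)
Lemma tau_neq_cmp (k b : 'I_n) : k \notin pair ->
  [/\ (tau b < k)%N = (b < k)%N, (k < tau b)%N = (k < b)%N
    & (tau b == k :> nat) = (b == k :> nat)].
Proof.
rewrite !inE negb_or => /andP[/eqP ki /eqP ki1].
have ki' : val k <> val i by move/val_inj.
have ki1' : val k <> val i1 by move/val_inj.
by case: tpermP => // ->; move: Hi1 ki' ki1' => /=; split; lia.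
Qed.

Lemma invw_taul (a b : 'I_n) : ~~ ((a \in pair) && (b \in pair)) ->
  invw t (tau a) b = invw t a b.
Proof.
case aP: (a \in pair) => /=; last by rewrite tau_id ?aP.
by move=> /(tau_neq_cmp a)[e1 e2 e3]; rewrite /invw e1 e3.
Qed.

Lemma invw_taur (a b : 'I_n) : ~~ ((a \in pair) && (b \in pair)) ->
  invw t a (tau b) = invw t a b.
Proof.
case bP: (b \in pair); last by rewrite tau_id ?bP.
by rewrite andbT => /(tau_neq_cmp b)[e1 e2 e3]; rewrite /invw e2 eq_sym e3 eq_sym.
Qed.

Lemma stepw_taul z (a b : 'I_n) : ~~ ((a \in pair) && (b \in pair)) ->
  stepw t z (tau a) b = stepw t z a b.
Proof.
case aP: (a \in pair) => /=; last by rewrite tau_id ?aP.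
by move=> /(tau_neq_cmp a)[e1 e2 e3]; rewrite /stepw e1 e3.
Qed.

Lemma stepw_taur z (a b : 'I_n) : ~~ ((a \in pair) && (b \in pair)) ->
  stepw t z a (tau b) = stepw t z a b.
Proof.
case bP: (b \in pair); last by rewrite tau_id ?bP.
by rewrite andbT => /(tau_neq_cmp b)[e1 e2 e3]; rewrite /stepw e2 eq_sym e3 eq_sym.
Qed.

Lemma pairw_taul c u v (a b : 'I_n) : ~~ ((a \in pair) && (b \in pair)) ->
  pairw c u v (tau a) b = pairw c u v a b.
Proof. by move=> ab; rewrite /pairw invw_taur 1?andbC // stepw_taul. Qed.

Lemma pairw_taur c u v (a b : 'I_n) : ~~ ((a \in pair) && (b \in pair)) ->
  pairw c u v a (tau b) = pairw c u v a b.
Proof. by move=> ab; rewrite /pairw invw_taul 1?andbC // stepw_taur. Qed.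

(** Besides the normalisation, the factors in which at most one box carries [i] or [i1]; by
    [tau_neq_cmp] they do not notice a relabelling of either column. *)
Definition trans_rest c (s s' : column) : A :=
  (normalized c.+1 s')%:R
  * (\prod_(u | inrow c u)
       \prod_(v | inrow c.+1 v && ~~ ((u \in lab c s) && (v \in lab c.+1 s')))
         pairw c u v (s u) (s' v))
  * (\prod_(u | inrow c.+1 u)
       \prod_(v | inrow c.+1 v && ~~ ((u \in lab c.+1 s') && (v \in lab c.+1 s')))
         (if (u < v)%N then invw t (s' u) (s' v) else 1)).

Definition trans_lab c (s s' : column) : A :=
  (\prod_(u in lab c s) \prod_(v in lab c.+1 s') pairw c u v (s u) (s' v))
  * \prod_(u in lab c.+1 s') \prod_(v in lab c.+1 s')
         (if (u < v)%N then invw t (s' u) (s' v) else 1).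

Lemma transwE c s s' : transw alpha q t c s s' = trans_rest c s s' * trans_lab c s s'.
Proof.
rewrite /transw /inter /inner.
rewrite (@prod2_setID _ _ (inrow c) (inrow c.+1) (lab c s) (lab c.+1 s')); try exact: lab_inrow.
rewrite (@prod2_setID _ _ (inrow c.+1) (inrow c.+1) (lab c.+1 s') (lab c.+1 s')); try exact: lab_inrow.
by rewrite /trans_rest /trans_lab [_%:R * (_ * _)]mulrA mulrACA.
Qed.

Lemma mem_lab c s r : inrow c r -> (r \in lab c s) = (s r \in pair).
Proof. by rewrite inE => ->. Qed.

Lemma trans_rest_relabell c s s' : trans_rest c (relabel c s) s' = trans_rest c s s'.
Proof.
rewrite /trans_rest lab_relabel; congr (_ * _ * _).
apply: eq_bigr => u cu; apply: eq_bigr => v /andP[cv].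
by rewrite !mem_lab // relabel_in // => uv; rewrite pairw_taul.
Qed.

Lemma normalized_relabel c s : normalized c (relabel c s) = normalized c s.
Proof. by apply: eq_forallb => v; rewrite ffunE; case: ifP. Qed.

Lemma trans_rest_relabelr c s s' : trans_rest c s (relabel c.+1 s') = trans_rest c s s'.
Proof.
rewrite /trans_rest lab_relabel normalized_relabel; congr (_ * _ * _).
  apply: eq_bigr => u cu; apply: eq_bigr => v /andP[cv].
  by rewrite !mem_lab // relabel_in // => uv; rewrite pairw_taur.
apply: eq_bigr => u cu; apply: eq_bigr => v /andP[cv].
rewrite !mem_lab // !relabel_in // => uv.
by rewrite invw_taul ?mem_tperm // invw_taur.
Qed.

Definition col_rest (x : 'I_n -> A) c (s : column) : A :=
  \prod_(v | inrow c v && (v \notin lab c s)) x (s v).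

Lemma colxE x c s : colx x c s = col_rest x c s * \prod_(v in lab c s) x (s v).
Proof.
rewrite /colx (bigID (fun v => v \in lab c s)) /= mulrC; congr (_ * _).
by apply: eq_bigl => v; rewrite inE andbA andbb.
Qed.

Lemma col_rest_relabel x c s : col_rest x c (relabel c s) = col_rest x c s.
Proof.
rewrite /col_rest lab_relabel; apply: eq_bigr => v /andP[_ vl].
by rewrite relabel_notin.
Qed.

Lemma col_rest_swap x c s : col_rest (fun k => x (tau k)) c s = col_rest x c s.
Proof. by apply: eq_bigr => v /andP[cv vl]; rewrite tau_id // (lab_notin cv). Qed.

Local Notation w c u v := (pairw c u v i i).
Local Notation m c u v := (pairw c u v i i1).

Lemma lt_pair : (i < i1)%N. Proof. by rewrite Hi1. Qed.
Lemma eq_pair : (i == i1 :> nat) = false. Proof. by rewrite ltn_eqF // lt_pair. Qed.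
Lemma eq_pair' : (i1 == i :> nat) = false. Proof. by rewrite gtn_eqF // lt_pair. Qed.
Lemma lt_pair' : (i1 < i)%N = false. Proof. by rewrite ltnNge ltnW // lt_pair. Qed.
Definition cmp_pair := (lt_pair, lt_pair', eq_pair, eq_pair').

Lemma pairw_i1i1 c u v : pairw c u v i1 i1 = w c u v.
Proof. by rewrite /pairw /invw /stepw !eqxx. Qed.

(** The weights for [i1] then [i], [i] then [i1], and equal labels are $(t, 1, 0)$ if [u] is above
    [v], $(1-t, (1-t)z, 1-zt)$ if [u = v], and $(1,1,1)$ otherwise. *)
Lemma pairw_i1i c u v : pairw c u v i1 i = t * m c u v + (1 - t) * w c u v.
Proof.
rewrite /pairw /invw /stepw !eqxx !cmp_pair.
by case: ifP => _; [|case: ifP => _]; rewrite /= ?expr0 ?expr1; ring.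
Qed.

(* The configurations of up to four boxes labelled [i] or [i1] enter the Hecke
   relation only through the next two alternatives. *)
Lemma w_source c (a b v : 'I_n) : (a < b)%N -> w c a v = 0 \/ w c b v = m c b v.
Proof.
move=> ab; rewrite /pairw /invw eqxx; case: (ltnP a v) => av; first by left.
right; have vb : (v < b)%N := leq_ltn_trans av ab.
by rewrite ltnNge (ltnW vb) /= -val_eqE /= gtn_eqF.
Qed.

Lemma w_target c (u a b : 'I_n) : (a < b)%N -> w c u b = 0 \/ w c u a = m c u a.
Proof.
move=> ab; rewrite /pairw /invw eqxx; case: (ltnP u b) => ub; first by left.
right; have au : (a < u)%N := leq_trans ab ub.
by rewrite ltnNge (ltnW au) /= -val_eqE /= gtn_eqF.
Qed.

(* The topmost box of column [c] labelled [i] or [i1] has label [k]. *)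
Definition leads (k : 'I_n) c (s : column) : bool :=
  [exists a in lab c s, (s a == k) && [forall b in lab c s, (a <= b)%N]].

Lemma leads_relabel c s : leads i c (relabel c s) = leads i1 c s.
Proof.
rewrite /leads lab_relabel; apply: eq_existsb => a.
case al: (a \in lab c s) => //=; congr (_ && _).
have ca : inrow c a := lab_inrow al.
by rewrite relabel_in // -[RHS](inj_eq (@perm_inj _ tau)) tpermR.
Qed.

Lemma leads_exclusive c s : leads i1 c s -> ~~ leads i c s.
Proof.
move=> /exists_inP[a al /andP[/eqP sa /forall_inP ma]].
apply/exists_inP => -[b bl /andP[/eqP sb /forall_inP mb]].
have ab : a = b by apply/val_inj/anti_leq; rewrite ma ?mb.
by move: eq_pair; rewrite -sa -sb ab eqxx.
Qed.

Lemma leadsP c s : [\/ lab c s = set0, leads i c s | leads i1 c s].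
Proof.
have [e|[a0 a0l]] := set_0Vmem (lab c s); first by constructor 1.
case: (arg_minnP (fun r : 'I_n => val r) a0l) => a al am.
have fa : [forall b in lab c s, (a <= b)%N] by apply/forall_inP.
have : a \in lab c s := al.
rewrite [in X in X -> _]inE => /andP[_ /set2P[sa|sa]]; [constructor 2|constructor 3].
all: by apply/exists_inP; exists a => //; rewrite sa eqxx.
Qed.

Lemma leads_neq0 k c s : leads k c s -> lab c s != set0.
Proof. by case/exists_inP => a al _; apply/set0Pn; exists a. Qed.

(** Relabelling is an involution matching the columns led by [i] with those led by [i1]. *)
Lemma sum_leads c (f : column -> A) :
  \sum_s f s = \sum_(s | lab c s == set0) f s
    + \sum_(s | leads i c s) (f s + f (relabel c s)).
Proof.
rewrite (bigID (fun s => lab c s == set0)) /=; congr (_ + _).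
rewrite (bigID (leads i c)) /= big_split /=; congr (_ + _).
  apply: eq_bigl => s; apply/andP/idP => [[]//|l]; split=> //; exact: leads_neq0 l.
rewrite [RHS](reindex_inj (inv_inj (@relabelK c))) /=.
apply: eq_big => s; last by rewrite relabelK.
rewrite leads_relabel; apply/andP/idP => [[l0 li]|li].
  by case: (leadsP c s) l0 li => [->|->|//]; rewrite ?eqxx.
by split; [exact: leads_neq0 li|exact: leads_exclusive].
Qed.

(** Since the entries are distinct, each of the two labels occurs at most once. *)
Lemma lab_cases c (s : column) : {in inrow c &, injective s} -> leads i c s ->
  exists2 a, s a = i & lab c s = [set a] \/
    exists b : 'I_n, [/\ (a < b)%N, s b = i1 & lab c s = [set a; b]].
Proof.
move=> inj /exists_inP[a al /andP[/eqP sa /forall_inP ma]]; exists a => //.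
have ca := lab_inrow al.
case: (set_0Vmem (lab c s :\ a)) => [e|[b]].
  by left; rewrite -(setD1K al) e setU0.
rewrite !inE => /and3P[ba cb sb].
have sbi : s b = i1.
  case/orP: sb => /eqP // sb; case/eqP: ba.
  by apply: inj => //; rewrite sb sa.
right; exists b; split=> //.
  by rewrite ltn_neqAle val_eqE eq_sym ba ma // !inE cb sb.
apply/setP => r; rewrite !inE; apply/andP/orP => [[cr /orP[]/eqP sr]|[]/eqP->].
- by left; apply/eqP; apply: inj => //; rewrite sr sa.
- by right; apply/eqP; apply: inj => //; rewrite sr sbi.
- by rewrite sa eqxx.
- by rewrite sbi eqxx orbT.
Qed.

Lemma trans_lab_single c (s s' : column) a : lab c.+1 s' = [set a] ->
  trans_lab c s s' = \prod_(u in lab c s) pairw c u a (s u) (s' a).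
Proof.
move=> e; rewrite /trans_lab e !big_set1 ltnn mulr1.
by apply: eq_bigr => u _; rewrite big_set1.
Qed.

Lemma trans_lab_double c (s s' : column) (a b : 'I_n) : (a < b)%N ->
  lab c.+1 s' = [set a; b] ->
  trans_lab c s s' = (\prod_(u in lab c s)
     (pairw c u a (s u) (s' a) * pairw c u b (s u) (s' b))) * invw t (s' a) (s' b).
Proof.
move=> ab e; have nab : a \notin [set b] by rewrite inE neq_ltn ab.
rewrite /trans_lab e !big_setU1 // !big_set1 /= !big_setU1 // !big_set1.
rewrite !ltnn ab ltnNge (ltnW ab) /= !mulr1 mul1r; congr (_ * _).
by apply: eq_bigr => u _; rewrite big_setU1 // big_set1.
Qed.

Definition term x k c (s s' : column) : A :=
  transw alpha q t c s s' * colx x c.+1 s' * tail x k c.+1 s'.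

Lemma termE x k c s s' : term x k c s s' =
  trans_rest c s s' * col_rest x c.+1 s' *
  (trans_lab c s s' * (\prod_(v in lab c.+1 s') x (s' v)) * tail x k c.+1 s').
Proof. by rewrite /term transwE colxE; ring. Qed.

Lemma transw_inner_eq0 c (s s' : column) :
  ~ {in inrow c.+1 &, injective s'} -> transw alpha q t c s s' = 0.
Proof.
move=> ninj; rewrite /transw.
suff -> : inner c.+1 s' = 0 by rewrite mulr0.
case: (boolP [exists u, exists v, [&& inrow c.+1 u, inrow c.+1 v, u != v & s' u == s' v]]).
  by move=> /existsP[u /existsP[v /and4P[cu cv uv /eqP e]]]; apply: (inner_eq0 _ cu cv uv e).
rewrite negb_exists => /forallP H; case: ninj => u v cu cv e.
apply/eqP/negPn/negP => nuv; move: (H u); rewrite negb_exists => /forallP/(_ v)/negP.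
by apply; apply/and4P; split=> //; apply/eqP.
Qed.

Lemma relabel_inj c (s : column) :
  {in inrow c &, injective (relabel c s)} -> {in inrow c &, injective s}.
Proof.
move=> inj u v cu cv e; apply: inj => //.
by rewrite !relabel_in // e.
Qed.

(** The invariant of the induction on columns. Columns without the two labels are included because
    the labels may appear or disappear from one column to the next. *)
Definition tail_hecke x k c (s : column) : Prop :=
  let xs := fun l => x (tau l) in
  (lab c s = set0 -> tail x k c s = tail xs k c s) /\
  (leads i c s -> hrel t (x i) (x i1) (tail x k c s) (tail x k c (relabel c s))
     (tail xs k c s) (tail xs k c (relabel c s))).

(** The sum over the next column is split according to whether it has no, one or two boxes with the
    two labels. If [s] has such boxes too, the last two cases are [hrel_single] and
    [hrel_double]. *)
Lemma tail_hecke_step x k c (s : column) :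
  {in inrow c &, injective s} ->
  (forall s' : column, {in inrow c.+1 &, injective s'} -> tail_hecke x k c.+1 s') ->
  tail_hecke x k.+1 c s.
Proof.
move=> injs IH; pose xs := fun k => x (tau k).
have xsi : xs i = x i1 by rewrite /xs tpermL.
have xsi1 : xs i1 = x i by rewrite /xs tpermR.
have tailS y s0 : tail y k.+1 c s0 = \sum_(s' | lab c.+1 s' == set0) term y k c s0 s'
    + \sum_(s' | leads i c.+1 s') (term y k c s0 s' + term y k c s0 (relabel c.+1 s')).
  by rewrite -sum_leads.
have term_eq0 y s0 (s' : column) : ~ {in inrow c.+1 &, injective s'} -> term y k c s0 s' = 0.
  by move=> ninj; rewrite /term transw_inner_eq0 // !mul0r.
(* A repeated entry kills the terms of a column and of its relabelling, so the entries may be taken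
   distinct below. *)
have inj_or (s' : column) : {in inrow c.+1 &, injective s'} \/
    (forall y s0, term y k c s0 s' = 0 /\ term y k c s0 (relabel c.+1 s') = 0).
  case: (boolP [forall u in inrow c.+1, forall v in inrow c.+1, (s' u == s' v) ==> (u == v)]) => H.
    left=> u v cu cv e; move/forall_inP: H => /(_ u cu)/forall_inP/(_ v cv).
    by rewrite e eqxx => /eqP.
  right=> y s0.
  have ninj : ~ {in inrow c.+1 &, injective s'}.
    move=> inj; case/negP: H; apply/forall_inP => u cu; apply/forall_inP => v cv.
    by apply/implyP => /eqP e; apply/eqP; apply: inj.
  by split; apply: term_eq0 => // /relabel_inj.
have term0 s0 (s' : column) : lab c.+1 s' = set0 -> term x k c s0 s' = term xs k c s0 s'.
  move=> l0; case: (inj_or s') => [inj|e]; last by rewrite !(e _ s0).1.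
  by rewrite !termE col_rest_swap l0 !big_set0 (IH s' inj).1.
rewrite /tail_hecke -/xs; split=> [l0|lead].
  rewrite !tailS; congr (_ + _); apply: eq_bigr => s'; first by move/eqP/term0.
  move=> lead'; case: (inj_or s') => [inj'|e]; last by rewrite !(e _ s).1 !(e _ s).2.
  have [a' sa' sh'] := lab_cases inj' lead'; have [e1 e2] := (IH s' inj').2 lead'.
  rewrite !termE !trans_rest_relabelr !col_rest_relabel !col_rest_swap -!mulrDr.
  congr (_ * _); rewrite !lab_relabel.
  (* [s] has neither label. One label in [s']: both choices have weight 1, and the second relation
     applies. Two labels: the weights are [t] and 1, and the first relation applies. *)
  case: sh' => [la'|[b' [ab' sb' lab']]].
    have ca' : inrow c.+1 a' by apply: (@lab_inrow c.+1 s'); rewrite la' inE.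
    rewrite !(@trans_lab_single _ _ _ a') ?lab_relabel // l0 !big_set0 la' !big_set1.
    by rewrite relabel_in // sa' tpermL xsi xsi1 !mul1r.
  have ca' : inrow c.+1 a' by apply: (@lab_inrow c.+1 s'); rewrite lab' !inE eqxx.
  have cb' : inrow c.+1 b' by apply: (@lab_inrow c.+1 s'); rewrite lab' !inE eqxx orbT.
  have nab : a' \notin [set b'] by rewrite inE neq_ltn ab'.
  rewrite !(@trans_lab_double _ _ _ a' b') ?lab_relabel // l0 !big_set0 lab'.
  rewrite !big_setU1 // !big_set1 !relabel_in // sa' sb' tpermL tpermR xsi xsi1.
  rewrite /invw !cmp_pair !mul1r expr1 /=; move: e1; rewrite -/xs => e1.
  by transitivity (x i * x i1 * (t * tail x k c.+1 s' + tail x k c.+1 (relabel c.+1 s')));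
    [ring | rewrite e1; ring].
rewrite !tailS; apply: hrelD; apply: hrel_sum => s'.
  (* Without labels in the next column, [s] and its relabelling give the same term. *)
  move/eqP => l0'; have := term0 s s' l0'.
  have E y : term y k c (relabel c s) s' = term y k c s s'.
    rewrite !termE trans_rest_relabell; congr (_ * (_ * _ * _)).
    rewrite /trans_lab lab_relabel l0' !big_set0; congr (_ * _).
    by rewrite !big1 // => u _; rewrite big_set0.
  by rewrite !E; apply: hrel_sym.
move=> lead'; case: (inj_or s') => [inj'|e]; last first.
  rewrite !(e _ s).1 !(e _ s).2 !(e _ (relabel c s)).1 !(e _ (relabel c s)).2 !addr0.
  exact: hrel_sym.
have [a' sa' sh'] := lab_cases inj' lead'; have := (IH s' inj').2 lead'; rewrite -/xs => H.
have [a sa sh] := lab_cases injs lead.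
rewrite !termE !(trans_rest_relabelr, trans_rest_relabell) !col_rest_relabel !col_rest_swap -!mulrDr.
apply: hrelZ; rewrite !lab_relabel.
have ca : inrow c a by apply: (@lab_inrow c s); case: sh => [->|[b [_ _ ->]]]; rewrite !inE eqxx.
have ca' : inrow c.+1 a'.
  by apply: (@lab_inrow c.+1 s'); case: sh' => [->|[b [_ _ ->]]]; rewrite !inE eqxx.
case: sh' => [la'|[b' [ab' sb' lab']]].
  rewrite !(@trans_lab_single _ _ _ a') ?lab_relabel // la' !big_set1.
  rewrite relabel_in // sa' tpermL xsi xsi1 -!mulrA.
  (* Each of the two conditions on the matrix is checked for one and for two labelled boxes in
     [s]. *)
  apply: hrel_single => //; case: sh => [->|[b [ab sb lab2]]].
  - by rewrite !big_set1 relabel_in // sa tpermL pairw_i1i1.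
  - have cb : inrow c b by apply: (@lab_inrow c s); rewrite lab2 !inE eqxx orbT.
    have nab : a \notin [set b] by rewrite inE neq_ltn ab.
    rewrite lab2 !big_setU1 // !big_set1 !relabel_in // sa sb tpermL tpermR.
    by rewrite pairw_i1i1 !pairw_i1i /=; case: (w_source c a' ab) => ->; ring.
  - by rewrite !big_set1 relabel_in // sa tpermL pairw_i1i.
  have cb : inrow c b by apply: (@lab_inrow c s); rewrite lab2 !inE eqxx orbT.
  have nab : a \notin [set b] by rewrite inE neq_ltn ab.
  rewrite lab2 !big_setU1 // !big_set1 !relabel_in // sa sb tpermL tpermR.
  by rewrite pairw_i1i1 !pairw_i1i /=; case: (w_source c a' ab) => ->; ring.
have cb' : inrow c.+1 b' by apply: (@lab_inrow c.+1 s'); rewrite lab' !inE eqxx orbT.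
have nab' : a' \notin [set b'] by rewrite inE neq_ltn ab'.
rewrite !(@trans_lab_double _ _ _ a' b') ?lab_relabel // lab' !(big_setU1, big_set1) //=.
rewrite !relabel_in // sa' sb' tpermL tpermR xsi xsi1.
rewrite /invw !cmp_pair expr1 expr0 !mulr1 ![x i1 * x i]mulrC.
(* Both orders of the labels in [s'] give the same monomial, which is taken out first. *)
rewrite ![_ * (x i * x i1)]mulrC -!mulrA -!mulrDr.
do 2 apply: hrelZ.
rewrite ![_ * (t * _)]mulrA; case: sh => [->|[b [ab sb lab2]]].
  rewrite !big_set1 relabel_in // sa tpermL !pairw_i1i1 !pairw_i1i /=.
  by apply: hrel_double => //; case: (w_target c a ab') => ->; ring.
have cb : inrow c b by apply: (@lab_inrow c s); rewrite lab2 !inE eqxx orbT.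
have nab : a \notin [set b] by rewrite inE neq_ltn ab.
rewrite lab2 !big_setU1 // !big_set1 !relabel_in // sa sb tpermL tpermR.
rewrite !pairw_i1i1 !pairw_i1i /=.
have [E1 E2] := hecke_double_entries t (m c a b') (w_source c a' ab) (w_source c b' ab)
  (w_target c a ab') (w_target c b ab').
exact: hrel_double.
Qed.

Lemma tail_heckeP x k c (s : column) :
  {in inrow c &, injective s} -> tail_hecke x k c s.
Proof.
elim: k c s => [|k IH] c s inj; last by apply: tail_hecke_step => // s'; apply: IH.
by split=> // _; apply: hrel_sym.
Qed.

End Relabel.

(** * The statistics column by column *)

(** With the tie rule, e <= a, a < b and b <= e are the three cyclic comparisons: they cannot all
    hold or all fail, and exactly one holds for an inversion triple. *)
Lemma coinv_inversion (a e b : nat) :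
  (~~ inversion a e b + 1 = (e <= a) + (a < b) + (b <= e))%N.
Proof.
rewrite /inversion /ltk /=.
case: (ltngtP a b); case: (ltngtP b e); case: (ltngtP a e); lia.
Qed.

Section Columns.
Local Open Scope nat_scope.
Variables (n : nat) (alpha : 'I_n -> nat).
Notation column := {ffun 'I_n -> 'I_n}.
Notation m := (maxpart alpha).
Notation filling := (filling alpha).
Notation box := (box alpha).
Local Notation inrow := (in_row alpha).
Local Notation normalized := (normalized alpha).

Definition colof (F : filling) (c : nat) : column := [ffun r => F (r, inord c)].

Lemma box_big (T : Type) (idx : T) (op : Monoid.com_law idx) (f : 'I_n -> nat -> T) :
  \big[op/idx]_(u : box | (0 < u.2)%N && inshape u) f u.1 u.2
  = \big[op/idx]_(c < m) \big[op/idx]_(r | inrow c.+1 r) f r c.+1.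
Proof.
transitivity (\big[op/idx]_(r : 'I_n) \big[op/idx]_(c < m.+1 | (0 < c)%N && inrow c r) f r c).
  rewrite pair_big_dep /=; by apply: eq_bigl => -[].
rewrite (eq_bigr (fun r => \big[op/idx]_(c < m.+1)
   if (0 < c)%N && inrow c r then f r c else idx)); last by move=> r _; rewrite big_mkcond.
rewrite exchange_big /= big_ord_recl /= big1 // Monoid.mul1m.
by apply: eq_bigr => c _; rewrite [RHS]big_mkcond.
Qed.

Lemma maxpart_ge r : (alpha r <= m)%N.
Proof. exact: leq_bigmax. Qed.

Definition validcol c (s s' : column) : bool :=
  [&& normalized c.+1 s',
    [forall u, forall v, [&& inrow c u, inrow c.+1 v & (u < v)%N] ==> (s u != s' v)] &
    [forall u, forall v, [&& inrow c.+1 u, inrow c.+1 v & (u < v)%N] ==> (s' u != s' v)]].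

Lemma validcol_norm c s s' : validcol c s s' -> normalized c.+1 s'.
Proof. by case/and3P. Qed.

Lemma validcol_inter c (s s' : column) u v : validcol c s s' ->
  inrow c u -> inrow c.+1 v -> (u < v)%N -> s u != s' v.
Proof.
case/and3P => _ /forallP /(_ u) /forallP /(_ v) /implyP H _ cu cv uv.
by apply: H; rewrite cu cv.
Qed.

Lemma validcol_inner c (s s' : column) u v : validcol c s s' ->
  inrow c.+1 u -> inrow c.+1 v -> (u < v)%N -> s' u != s' v.
Proof.
case/and3P => _ _ /forallP /(_ u) /forallP /(_ v) /implyP H cu cv uv.
by apply: H; rewrite cu cv.
Qed.

Lemma colofE (F : filling) (r : 'I_n) (c : 'I_m.+1) : F (r, c) = colof F c r.
Proof. by rewrite ffunE inord_val. Qed.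

(** Attacks relate only boxes of equal or adjacent columns. The entries of the basement, which
    [validcol] compares only with the next column, are distinct because [sigma] is a permutation. *)
Lemma NAFE (sigma : 'S_n) (F : filling) : colof F 0 = [ffun r => sigma r] ->
  NAF sigma F = [forall c : 'I_m, validcol c (colof F c) (colof F c.+1)].
Proof.
move=> F0; apply/idP/forallP => [/and3P[_ /forallP nm /forallP na] c|H].
  have cm : (c < m.+1)%N := ltnW (ltn_ord c).
  have c1m : (c.+1 < m.+1)%N := ltn_ord c.
  apply/and3P; split.
  - apply/forallP => v; apply/implyP => cv; rewrite ffunE.
    by have /implyP := nm (v, inord c.+1); apply; rewrite /inshape /= inordK.
  - apply/forallP => u; apply/forallP => v; apply/implyP => /and3P[cu cv uv].
    apply/negP => /eqP; rewrite !ffunE => e.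
    have /forallP /(_ (v, inord c.+1)) := na (u, inord c).
    rewrite /inshape /= !inordK // e !eqxx uv orbT /= implybF => /negP; apply.
    apply/and4P; split=> //; apply/eqP => -[e1 _]; by rewrite e1 ltnn in uv.
  - apply/forallP => u; apply/forallP => v; apply/implyP => /and3P[cu cv uv].
    apply/negP => /eqP; rewrite !ffunE => e.
    have /forallP /(_ (v, inord c.+1)) := na (u, inord c.+1).
    rewrite /inshape /= !inordK // e !eqxx /= implybF => /negP; apply.
    apply/and4P; split=> //; apply/eqP => -[e1]; by rewrite e1 ltnn in uv.
have F0' r : F (r, ord0) = sigma r by rewrite colofE F0 ffunE.
have inner_ok (c : nat) u v : (c <= m)%N -> inrow c u -> inrow c v -> (u < v)%N ->
    colof F c u != colof F c v.
  case: c => [|c] cm cu cv uv.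
    by rewrite F0 !ffunE (inj_eq perm_inj) neq_ltn uv.
  exact: (validcol_inner (H (Ordinal cm))).
apply/and3P; split; first by apply/forallP => r; rewrite F0'.
  apply/forallP => -[v [[|c] cm]]; apply/implyP; rewrite /inshape //= => cv.
  rewrite colofE /=; have := validcol_norm (H (Ordinal (cm : (c < m)%N))).
  by move=> /forallP /(_ v) /implyP; apply.
apply/forallP => -[u c]; apply/forallP => -[v d]; apply/implyP => /and4P[cu dv uv].
rewrite !colofE => /eqP e /=; apply/negP => /orP[/eqP cd|/andP[/eqP dc uv']].
  have {}uv : u != v.
    by apply: contra uv => /eqP ->; apply/eqP; congr (_, _); apply: val_inj.
  rewrite /inshape /= -cd in dv; rewrite -cd in e.
  case: (ltngtP u v) uv => [lt|lt|/val_inj ->]; rewrite ?eqxx // => _.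
    by have := inner_ok c _ _ (ltn_ord c : c <= m)%N cu dv lt; rewrite e eqxx.
  by have := inner_ok c _ _ (ltn_ord c : c <= m)%N dv cu lt; rewrite e eqxx.
have cm : (c < m)%N by have := ltn_ord d; rewrite dc.
have := validcol_inter (H (Ordinal cm)) cu; rewrite /inshape /= dc in dv.
by move=> /(_ v dv uv'); rewrite e dc eqxx.
Qed.

Definition descsum (f : 'I_n -> nat) c (s s' : column) : nat :=
  \sum_(u | inrow c.+1 u) (s u < s' u)%N * f u.

Definition crossings c (s s' : column) : nat :=
  \sum_(u | inrow c u) \sum_(v | inrow c.+1 v && (u < v)%N) (s' v < s u)%N.

Definition noninversions c (s : column) : nat :=
  \sum_(u | inrow c u) \sum_(v | inrow c v && (u < v)%N) (s u < s v)%N.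

Definition crosspairs c : nat :=
  \sum_(u | inrow c u) \sum_(v | inrow c.+1 v && (u < v)%N) 1.

(* The pair of boxes of column [c] in rows [u < v] belongs to a type A triple
   with column [c.-1] if [alpha v <= alpha u], and to a type B triple with column
   [c.+1] if [alpha u < alpha v]. *)
Definition noninv_ge c (s : column) : nat :=
  \sum_(u | inrow c u) \sum_(v | inrow c v && (u < v)%N)
    ((alpha v <= alpha u) && (s u < s v))%N.

Definition noninv_lt c (s : column) : nat :=
  \sum_(u | inrow c u) \sum_(v | inrow c v && (u < v)%N)
    ((alpha u < alpha v) && (s u < s v))%N.

Lemma noninversionsE c s : noninversions c s = (noninv_ge c s + noninv_lt c s)%N.
Proof.
rewrite -big_split; apply: eq_bigr => u _; rewrite -big_split; apply: eq_bigr => v _ /=.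
by case: (leqP (alpha v) (alpha u)); rewrite /= ?addn0.
Qed.

Definition colcoinv c (s s' : column) : nat :=
  \sum_(r : 'I_n) \sum_(r' : 'I_n)
    ((typeA alpha r r' c.+1 && ~~ inversion (s r) (s' r') (s' r))
     + (typeB alpha r r' c.+1 && ~~ inversion (s r) (s r') (s' r)))%N.

Lemma coinvE (F : filling) :
  coinv F = \sum_(c < m) colcoinv c (colof F c) (colof F c.+1).
Proof.
rewrite /coinv /colcoinv (eq_bigr (fun r => \sum_(c < m.+1) \sum_(r' : 'I_n)
    ((typeA alpha r r' c && ~~ inversion (entry F r c.-1) (entry F r' c) (entry F r c))
     + (typeB alpha r r' c && ~~ inversion (entry F r c.-1) (entry F r' c.-1) (entry F r c)))%N)).
  rewrite exchange_big /= big_ord_recl big1 ?add0n => [|r _]; last by rewrite big1.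
  apply: eq_bigr => c _; apply: eq_bigr => r _; apply: eq_bigr => r' _ /=.
  by rewrite /entry /= !ffunE.
by move=> r _; rewrite exchange_big.
Qed.

Lemma majE (F : filling) :
  maj F = \sum_(c < m) descsum (fun u => (leg alpha u c.+1).+1) c (colof F c) (colof F c.+1).
Proof.
rewrite /maj (eq_bigl (fun u : box => ((0 < u.2)%N && inshape u) && descent F u.1 u.2));
  last by move=> u; rewrite andbA.
rewrite big_mkcondr /= (box_big _ (fun r c => if descent F r c then (leg alpha r c).+1 else 0%N)).
apply: eq_bigr => c _; apply: eq_bigr => u _.
rewrite /descent /entry /= !ffunE.
by case: ifP; rewrite ?mul1n.
Qed.

Lemma armE r c : arm alpha r c.+1 =
  (\sum_(r' : 'I_n) typeA alpha r r' c.+1 + \sum_(r' : 'I_n) typeB alpha r r' c.+1)%N.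
Proof.
rewrite /arm; congr (_ + _)%N; rewrite -sum1dep_card big_mkcond.
  by apply: eq_bigr => r' _; rewrite /typeA; case: ifP.
by apply: eq_bigr => r' _; rewrite /typeB; case: ifP.
Qed.

Lemma sum_andb (P Q : pred 'I_n) (f : 'I_n -> 'I_n -> nat) :
  (\sum_(u | P u) \sum_(v | Q v && (u < v)) f u v
   = \sum_u \sum_v [&& P u, Q v & u < v] * f u v)%N.
Proof.
rewrite big_mkcond; apply: eq_bigr => u _; case: (P u) => /=; last first.
  by rewrite big1 // => v _; rewrite mul0n.
by rewrite big_mkcond; apply: eq_bigr => v _; case: ifP; rewrite ?mul1n.
Qed.

(** Boxes (u, c) and (v, c+1) with u < v lie in exactly one triple: type A of row u if alpha v <=
    alpha u, type B of row v otherwise. Summing the three brackets gives descents, crossings and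
    pairs within one column; [crosspairs] accounts for the -1 of each triple. *)
Lemma colcoinvE c (s s' : column) : {in inrow c &, injective s} -> validcol c s s' ->
  (colcoinv c s s' + crosspairs c =
   descsum (fun u => arm alpha u c.+1) c s s' + crossings c s s'
   + noninv_ge c.+1 s' + noninv_lt c s)%N.
Proof.
move=> injs V; rewrite /colcoinv /crosspairs /crossings /noninv_ge /noninv_lt !sum_andb.
have -> : descsum (fun u => arm alpha u c.+1) c s s' =
    (\sum_u \sum_v ((s u < s' u) * typeA alpha u v c.+1 + (s v < s' v) * typeB alpha v u c.+1))%N.
  rewrite /descsum big_mkcond /=.
  transitivity (\sum_u ((s u < s' u) * arm alpha u c.+1))%N.
    apply: eq_bigr => u _; case: ifP => // /negbT cu; rewrite armE !big1 ?muln0 // => v _.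
      by move: cu; rewrite /in_row /typeB; lia.
    by move: cu; rewrite /in_row /typeA; lia.
  under [RHS]eq_bigr => u _ do rewrite big_split /=.
  rewrite big_split /= [X in (_ + X)%N]exchange_big -big_split /=.
  by apply: eq_bigr => u _; rewrite armE mulnDr !big_distrr.
have sum_swap (f g : 'I_n -> 'I_n -> nat) :
    (\sum_u \sum_v (f u v + g u v) = \sum_u \sum_v (f u v + g v u))%N.
  transitivity (\sum_u \sum_v f u v + \sum_u \sum_v g u v)%N.
    by rewrite -big_split; apply: eq_bigr => u _; rewrite -big_split.
  rewrite [X in (_ + X)%N]exchange_big -big_split.
  by apply: eq_bigr => u _; rewrite -big_split.
(* The main row of a type B triple is the lower one; exchanging its indices makes [u] the upper row
   in both types. *)
rewrite [in LHS]sum_swap.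
rewrite -!big_split /=; apply: eq_bigr => u _; rewrite -!big_split /=; apply: eq_bigr => v _.
case uv: (u < v)%N; last by rewrite /typeA /typeB uv /= !andbF !muln0.
case: (boolP (inrow c u && inrow c.+1 v)) => [/andP[cu cv]|ncuv]; last first.
  have -> : typeA alpha u v c.+1 = false.
    by apply: contraNF ncuv; rewrite /typeA /in_row; lia.
  have -> : typeB alpha v u c.+1 = false.
    by apply: contraNF ncuv; rewrite /typeB /in_row; lia.
  have -> : [&& inrow c.+1 u, inrow c.+1 v & true] = false.
    by apply: contraNF ncuv; rewrite /in_row; lia.
  have := ncuv; rewrite negb_and => /orP[/negPf nc|/negPf nc]; rewrite nc ?andbF /= !muln0 //.
  case: (ltnP (alpha u) (alpha v)) nc => //= lt; rewrite ?andbF ?muln0 // => nc.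
  case cu: (inrow c u) => //=; move: nc cu; rewrite /in_row; lia.
have neq : (s u : nat) != s' v := validcol_inter V cu cv uv.
case: (leqP (alpha v) (alpha u)) => le.
  have -> : typeA alpha u v c.+1 by rewrite /typeA uv le (cv : (c.+1 <= alpha v)%N).
  have -> : typeB alpha v u c.+1 = false by rewrite /typeB !ltnNge le !andbF.
  have cu' : inrow c.+1 u := leq_trans cv le.
  have neq' : (s' u : nat) != s' v := validcol_inner V cu' cv uv.
  have := coinv_inversion (s u) (s' v) (s' u).
  rewrite cu cv cu' /= !muln0 !mul1n; move: neq neq'; lia.
have -> : typeB alpha v u c.+1 by rewrite /typeB uv le (cu : (c <= alpha u)%N).
have -> : typeA alpha u v c.+1 = false by rewrite /typeA (leqNgt (alpha v)) le !andbF.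
have cv' : inrow c v by apply: leq_trans cv.
have neq' : (s u : nat) != s v.
  by apply/eqP => /val_inj /injs e; move: uv; rewrite e // ltnn.
have := coinv_inversion (s v) (s u) (s' v).
rewrite cu cv cv' /= !muln0 !mul1n; move: neq neq'; lia.
Qed.

Lemma noninv_lt_maxpart s : noninv_lt m s = 0%N.
Proof.
rewrite /noninv_lt big1 // => u mu; rewrite big1 // => v _.
by rewrite ltnNge (leq_trans (maxpart_ge v) mu).
Qed.

(** The two kinds of pairs within a column come from different values of [c]; an index shift
    reunites them in [noninversions]. At the ends, column 0 leaves a term fixed by the basement, and
    column [m] leaves none since no row is longer. *)
Lemma coinv_columns (sigma : 'S_n) (F : filling) :
  colof F 0 = [ffun r => sigma r] -> NAF sigma F ->
  (coinv F + \sum_(c < m) crosspairs c =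
   noninv_lt 0 (colof F 0) + \sum_(c < m)
     (descsum (fun u => arm alpha u c.+1) c (colof F c) (colof F c.+1)
      + crossings c (colof F c) (colof F c.+1) + noninversions c.+1 (colof F c.+1)))%N.
Proof.
move=> F0; rewrite NAFE // => /forallP V.
have inj (c : 'I_m) : {in inrow c &, injective (colof F c)}.
  case: c => [[|c] cm] u v cu cv.
    by rewrite F0 !ffunE => /perm_inj.
  move=> e; case: (ltngtP u v) => [lt|lt|/val_inj //].
    by have := validcol_inner (V (Ordinal (ltnW cm))) cu cv lt; rewrite e eqxx.
  by have := validcol_inner (V (Ordinal (ltnW cm))) cv cu lt; rewrite e eqxx.
rewrite coinvE -big_split /=.
rewrite (eq_bigr _ (fun c _ => colcoinvE (inj c) (V c))) !big_split /=.
have -> : (\sum_(c < m) noninversions c.+1 (colof F c.+1)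
    = \sum_(c < m) noninv_ge c.+1 (colof F c.+1) + \sum_(c < m) noninv_lt c.+1 (colof F c.+1))%N.
  by rewrite -big_split; apply: eq_bigr => c _; rewrite noninversionsE.
have : (noninv_lt 0 (colof F 0) + \sum_(c < m) noninv_lt c.+1 (colof F c.+1)
   = \sum_(c < m) noninv_lt c (colof F c))%N.
  transitivity (\sum_(c < m.+1) noninv_lt c (colof F c))%N.
    by rewrite big_ord_recl.
  by rewrite big_ord_recr /= noninv_lt_maxpart addn0.
by move=> <-; rewrite -!addnA !(addnCA _ (noninv_lt 0 _)).
Qed.

End Columns.

(** * Fillings as sequences of columns *)

Section PathSum.
Variables (A : comNzRingType) (n : nat) (alpha : 'I_n -> nat) (q t : A).
Notation column := {ffun 'I_n -> 'I_n}.
Notation m := (maxpart alpha).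
Notation filling := (filling alpha).
Notation box := (box alpha).
Local Notation inrow := (in_row alpha).
Local Notation transw := (transw alpha q t).
Local Notation colx := (colx alpha).
Local Notation tail := (tail alpha q t).

(** Factor of a box once its denominator has been cleared. *)
Definition stepnum (r : 'I_n) (c : nat) (same : bool) : A :=
  if same then 1 - q ^+ (leg alpha r c).+1 * t ^+ (arm alpha r c).+1 else 1 - t.

Lemma stepw_boxz c r a b : stepw t (boxz alpha q t c r) a b =
  q ^+ ((a < b)%N * (leg alpha r c).+1) * t ^+ ((a < b)%N * arm alpha r c)
  * stepnum r c (a == b).
Proof.
rewrite /stepw /stepnum /boxz; case: eqVneq => [->|_].
  by rewrite ltnn !mul0n !expr0 !mul1r [t ^+ _.+1]exprSr mulrA.
by case: ltnP => _; rewrite /= ?mul1n ?mul0n ?expr0 ?expr1; ring.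
Qed.

Lemma prod_diag c (f : 'I_n -> 'I_n -> A) :
  \prod_(u | inrow c u) \prod_(v | inrow c.+1 v) (if u == v then f u v else 1)
  = \prod_(v | inrow c.+1 v) f v v.
Proof.
rewrite exchange_big /=; apply: eq_bigr => v cv.
rewrite (bigD1 v) /=; last exact: ltnW.
by rewrite eqxx big1 ?mulr1 // => u /andP[_ /negPf ->].
Qed.

Lemma expr_sum2 (P Q : pred 'I_n) (f : 'I_n -> 'I_n -> nat) :
  t ^+ (\sum_(u | P u) \sum_(v | Q v && (u < v)%N) f u v)%N
  = \prod_(u | P u) \prod_(v | Q v) (if (u < v)%N then t ^+ f u v else 1).
Proof.
rewrite -prodrXr; apply: eq_bigr => u _.
by rewrite -prodrXr big_mkcondr.
Qed.

(** On nonattacking columns no [invw] vanishes, so the exponents add up over the pairs of boxes. *)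
Lemma transw_valid c s s' : validcol alpha c s s' ->
  transw c s s' =
  q ^+ descsum alpha (fun u => (leg alpha u c.+1).+1) c s s'
  * t ^+ (descsum alpha (fun u => arm alpha u c.+1) c s s'
          + crossings alpha c s s' + noninversions alpha c.+1 s')
  * \prod_(u | inrow c.+1 u) stepnum u c.+1 (s u == s' u).
Proof.
move=> V; rewrite /transw (validcol_norm V) mul1r.
have -> : inner alpha t c.+1 s' = t ^+ noninversions alpha c.+1 s'.
  rewrite expr_sum2; apply: eq_bigr => u cu; apply: eq_bigr => v cv.
  case: ifP => // uv; rewrite /invw ifF //.
  exact/negbTE/(validcol_inner V).
have -> : inter alpha q t c s s' =
    t ^+ crossings alpha c s s' * \prod_(u | inrow c.+1 u)
      stepw t (boxz alpha q t c.+1 u) (s u) (s' u).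
  rewrite expr_sum2 -(prod_diag c (fun u v => stepw t (boxz alpha q t c.+1 u) (s u) (s' v))).
  rewrite -big_split; apply: eq_bigr => u cu; rewrite -big_split; apply: eq_bigr => v cv /=.
  rewrite /pairw; case: ifP => [uv|_]; last by rewrite mul1r.
  rewrite -val_eqE /= (ltn_eqF uv) mulr1 /invw ifF // eq_sym.
  exact/negbTE/(validcol_inter V).
under eq_bigr => u _ do rewrite stepw_boxz.
by rewrite !big_split /= !prodrXr !exprD; ring.
Qed.

Lemma transw_invalid c (s s' : column) : ~~ validcol alpha c s s' -> transw c s s' = 0.
Proof.
rewrite /validcol !negb_and => /or3P[/negPf nV|nV|nV]; rewrite /transw.
- by rewrite nV !mul0r.
- move: nV; rewrite negb_forall => /existsP[u]; rewrite negb_forall => /existsP[v].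
  rewrite negb_imply negbK => /andP[/and3P[cu cv uv] /eqP e].
  by rewrite /inter (bigD1 u) //= (bigD1 v) //= /pairw uv e /invw eqxx !mul0r mulr0 mul0r.
move: nV; rewrite negb_forall => /existsP[u]; rewrite negb_forall => /existsP[v].
rewrite negb_imply negbK => /andP[/and3P[cu cv uv] /eqP e].
rewrite (inner_eq0 _ cu cv _ e) ?mulr0 //.
by apply: contraTneq uv => ->; rewrite ltnn.
Qed.

Fixpoint pathw x c (s : column) (p : seq column) : A :=
  if p is s' :: p' then transw c s s' * colx x c.+1 s' * pathw x c.+1 s' p' else 1.

Lemma tail_path x k c s : tail x k c s = \sum_(p : k.-tuple column) pathw x c s p.
Proof.
elim: k c s => [|k IH] c s /=.
  rewrite (bigD1 [tuple]) //= big1 ?addr0 // => p.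
  by rewrite [p]tuple0 => /eqP.
under eq_bigr => s' _ do rewrite IH mulr_sumr.
rewrite pair_big /= (reindex (fun p : k.+1.-tuple column => (thead p, [tuple of behead p]))) /=.
  by apply: eq_bigr => p _; case/tupleP: p => s' p; rewrite theadE.
exists (fun sp : column * k.-tuple column => [tuple of sp.1 :: sp.2]) => [p _|[s' p] _].
  by rewrite /= -tuple_eta.
by rewrite theadE; congr (_, _); apply: val_inj.
Qed.

Lemma pathw_prod x s0 c s p :
  pathw x c s p = \prod_(d < size p)
    (transw (c + d) (nth s0 (s :: p) d) (nth s0 p d) * colx x (c + d).+1 (nth s0 p d)).
Proof.
elim: p c s => [|s' p IH] c s /=; first by rewrite big_ord0.
rewrite big_ord_recl /= addn0; congr (_ * _); rewrite IH.
by apply: eq_bigr => d _; rewrite /= addnS.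
Qed.

Definition filling_path (F : filling) : m.-tuple column :=
  [tuple colof F d.+1 | d < m].
(** With [s] in front, positions in the list are column numbers, and [u.2 <= m] stays within its m +
    1 entries. *)
Definition path_filling (s : column) (p : m.-tuple column) : filling :=
  [ffun u : box => nth s (s :: p) u.2 u.1].

Lemma tail_fillings x (s : column) : tail x m 0 s =
  \sum_(F : filling | colof F 0 == s)
    \prod_(c < m) (transw c (colof F c) (colof F c.+1) * colx x c.+1 (colof F c.+1)).
Proof.
have colP p c : (c <= m)%N -> colof (path_filling s p) c = nth s (s :: p) c.
  by move=> cm; apply/ffunP => r; rewrite !ffunE /= inordK.
rewrite tail_path (reindex_onto (path_filling s) filling_path) /=; last first.
  move=> F /eqP F0; apply/ffunP => -[r [[|c] cm]]; rewrite [RHS]colofE ffunE /=.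
    by rewrite -F0.
  have := tnth_nth s (filling_path F) (Ordinal (cm : (c < m)%N)).
  by rewrite tnth_mktuple /= => <-.
apply: eq_big => [p|p _].
  rewrite colP // eqxx /=; symmetry; apply/eqP/eq_from_tnth => d.
  by rewrite tnth_mktuple colP //= -tnth_nth.
rewrite (pathw_prod x s) size_tuple; apply: eq_bigr => c _.
by rewrite add0n !colP // ltnW.
Qed.

(** Only ring operations occur, so this sum commutes with ring morphisms, as the specialisation of
    [t] requires. *)
Definition Enum (sigma : 'S_n) (x : 'I_n -> A) : A :=
  \sum_(F : filling | NAF sigma F)
    ((\prod_(u : box | (0 < u.2)%N && inshape u) x (F u))
     * q ^+ maj F * t ^+ coinv F
     * \prod_(u : box | (0 < u.2)%N && inshape u)
         stepnum u.1 u.2 (F u == F (u.1, inord (u.2).-1))).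

Lemma Enum_tail (sigma : 'S_n) (x : 'I_n -> A) :
  let s := [ffun r => sigma r] : column in
  t ^+ (\sum_(c < m) crosspairs alpha c)%N * Enum sigma x
  = t ^+ noninv_lt alpha 0 s * tail x m 0 s.
Proof.
move=> s; rewrite tail_fillings /Enum !mulr_sumr.
rewrite big_mkcond [RHS]big_mkcond /=; apply: eq_bigr => F _.
case: eqP => [F0|nF0]; last first.
  rewrite ifF //; apply/negP => /and3P[/forallP H _ _]; case: nF0.
  apply/ffunP => r; rewrite !ffunE -(eqP (H r)); congr (F (_, _)).
  by apply: val_inj; rewrite /= inordK.
(* A filling outside [NAF] has two adjacent columns of transfer weight zero. *)
case: ifP => [naf|]; last first.
  rewrite NAFE // => /negbT; rewrite negb_forall => /existsP[c nV].
  by rewrite (bigD1 c) //= transw_invalid // !mul0r mulr0.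
have := coinv_columns F0 naf; rewrite F0 => E.
rewrite NAFE // in naf; move/forallP: naf => V.
rewrite big_split /=.
have -> : \prod_(u : box | (0 < u.2)%N && inshape u) x (F u)
    = \prod_(c < m) colx x c.+1 (colof F c.+1).
  rewrite /colx -(box_big alpha _ (fun r c => x (colof F c r))).
  by apply: eq_bigr => -[r c] _; rewrite colofE.
have -> : \prod_(u : box | (0 < u.2)%N && inshape u)
      stepnum u.1 u.2 (F u == F (u.1, inord (u.2).-1))
    = \prod_(c < m) \prod_(r | inrow c.+1 r)
        stepnum r c.+1 (colof F c r == colof F c.+1 r).
  rewrite -(box_big alpha _ (fun r c => stepnum r c (colof F c.-1 r == colof F c r))).
  by apply: eq_bigr => -[r c] _; rewrite colofE !ffunE eq_sym.
rewrite (eq_bigr _ (fun c _ => transw_valid (V c))) !big_split /= !prodrXr.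
rewrite majE.
have rearrange (a X Q T Z b T' : A) : b * T' = a * T ->
    a * (X * Q * T * Z) = b * (Q * T' * Z * X).
  by move=> e; transitivity (a * T * (X * Q * Z)); [ring | rewrite -e; ring].
by apply: rearrange; rewrite -!exprD -E addnC.
Qed.

End PathSum.

(** * Clearing denominators and specialising [t] *)

Lemma Enum_morph (A B : comNzRingType) (f : {rmorphism A -> B}) n (alpha : 'I_n -> nat)
    q t sigma x :
  f (Enum alpha q t sigma x) = Enum alpha (f q) (f t) sigma (fun k => f (x k)).
Proof.
rewrite rmorph_sum; apply: eq_bigr => F _; rewrite !rmorphM !rmorph_prod !rmorphXn.
congr (_ * _); apply: eq_bigr => u _; rewrite /stepnum; case: ifP => _.
  by rewrite rmorphB rmorph1 rmorphM !rmorphXn.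
by rewrite rmorphB rmorph1.
Qed.

(** A box repeating the entry on its left has no fraction in [Eperm]; [stepnum] gives it the full
    denominator, so the common denominator is the same for all fillings. *)
Lemma Eperm_Enum (R : fieldType) n (alpha : 'I_n -> nat) sigma (x : 'I_n -> R) q t :
  (forall (r : 'I_n) (c : nat), (0 < c)%N -> (c <= alpha r)%N ->
       1 - q ^+ (leg alpha r c).+1 * t ^+ (arm alpha r c).+1 != 0) ->
  Eperm alpha sigma x q t = Enum alpha q t sigma x /
    \prod_(u : box alpha | (0 < u.2)%N && inshape u)
      (1 - q ^+ (leg alpha u.1 u.2).+1 * t ^+ (arm alpha u.1 u.2).+1).
Proof.
move=> Hden; rewrite /Enum mulr_suml; apply: eq_bigr => F _.
rewrite -!mulrA; congr (_ * (_ * (_ * _))).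
rewrite -prodf_div.
rewrite (eq_bigl (fun u : box alpha => ((0 < u.2)%N && inshape u) && (F u != F (u.1, inord (u.2).-1))));
  last by move=> u; rewrite andbA.
rewrite big_mkcondr; apply: eq_bigr => u /andP[u0 us].
by rewrite /stepnum; case: eqP => //= _; rewrite divff // Hden.
Qed.

(** [t != 0] cancels the powers of [t] in [Enum_tail], and [t + 1 != 0] the factor in front of the
    common value. *)
Lemma Enum_sym_idom (A : idomainType) n (alpha : 'I_n -> nat) (sigma : 'S_n)
    (j j1 i i1 : 'I_n) (x : 'I_n -> A) (q t : A) :
  val j1 = (val j).+1 -> val i1 = (val i).+1 -> alpha j = alpha j1 ->
  [set sigma j; sigma j1] = [set i; i1] -> t != 0 -> t + 1 != 0 ->
  Enum alpha q t sigma x = Enum alpha q t sigma (fun k => x (tperm i i1 k)).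
Proof.
move=> Hj1 Hi1 Halpha Hsigma t0 t1.
have tX0 k : t ^+ k != 0 by rewrite expf_neq0.
apply: (mulfI (tX0 (\sum_(c < maxpart alpha) crosspairs alpha c)%N)).
rewrite !Enum_tail; congr (_ * _).
set s : {ffun 'I_n -> 'I_n} := [ffun r => sigma r].
have in0 r : in_row alpha 0 r by [].
have sj : s j != s j1.
  by rewrite !ffunE (inj_eq perm_inj) -val_eqE /= Hj1 neq_ltn ltnSn.
have sub r : r \in [set j; j1] -> sigma r \in [set i; i1].
  by rewrite -Hsigma => /set2P[]->; rewrite !inE eqxx ?orbT.
have labels : (sigma j, sigma j1) = (i, i1) \/ (sigma j, sigma j1) = (i1, i).
  have := sub j; have := sub j1; rewrite !inE !eqxx orbT => /(_ isT) H1 /(_ isT) H2.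
  move: sj; rewrite !ffunE; case/orP: H1 => /eqP ->; case/orP: H2 => /eqP -> ; rewrite ?eqxx //.
    by right.
  by left.
have Es : relabel alpha i i1 0 s = swap_rows j j1 s.
  apply/ffunP => r; rewrite !ffunE in0; case: (tpermP j j1 r) => [->|->|/eqP rj /eqP rj1].
  - by case: labels => -[-> ->]; rewrite ?tpermL ?tpermR.
  - by case: labels => -[-> ->]; rewrite ?tpermL ?tpermR.
  have : sigma r \notin [set i; i1].
    by rewrite -Hsigma !inE !(inj_eq perm_inj) negb_or rj rj1.
  exact: tau_id.
have inj : {in in_row alpha 0 &, injective s} by move=> u v _ _; rewrite !ffunE => /perm_inj.
have sw y : tail alpha q t y (maxpart alpha) 0 (relabel alpha i i1 0 s) =
    tail alpha q t y (maxpart alpha) 0 s by rewrite Es tail_swap.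
have cancel (a b : A) : t * a + a = t * b + b -> a = b.
  by rewrite -{2}[a]mul1r -{2}[b]mul1r -!mulrDl => /(mulfI t1).
case: (leadsP alpha i i1 0 s) => [l0|l|l].
- have : j \in lab alpha i i1 0 s by rewrite inE in0 ffunE sub // !inE eqxx.
  by rewrite l0 inE.
- have [_ /(_ l)[+ _]] := tail_heckeP q t Hi1 x (maxpart alpha) inj.
  by rewrite !sw => /cancel.
(* If [i1] leads the basement, the relation is applied to the relabelled basement, which [i]
   leads. *)
have inj' : {in in_row alpha 0 &, injective (relabel alpha i i1 0 s)}.
  by move=> u v _ _; rewrite !relabel_in // => /perm_inj; apply: inj.
have [_] := tail_heckeP q t Hi1 x (maxpart alpha) inj'.
by rewrite leads_relabel relabelK !sw => /(_ l)[/cancel].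
Qed.

Lemma Enum_sym (A : idomainType) n (alpha : 'I_n -> nat) (sigma : 'S_n)
    (j j1 i i1 : 'I_n) (x : 'I_n -> A) (q t : A) :
  val j1 = (val j).+1 -> val i1 = (val i).+1 -> alpha j = alpha j1 ->
  [set sigma j; sigma j1] = [set i; i1] ->
  Enum alpha q t sigma x = Enum alpha q t sigma (fun k => x (tperm i i1 k)).
Proof.
move=> Hj1 Hi1 Halpha Hsigma.
have evC (a : A) : horner_eval 0 a%:P = a by rewrite /horner_eval hornerC.
have evT : horner_eval 0 (t%:P + 'X) = t.
  by rewrite /horner_eval hornerD hornerC hornerX addr0.
(* A polynomial of degree one is nonzero; this serves for both t + 'X and t + 'X + 1. *)
have nz (a : A) : a%:P + 'X != 0.
  by rewrite addrC -size_poly_eq0 size_XaddC.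
have T1 : t%:P + 'X + 1 != 0 by rewrite addrAC -polyCD nz.
have := Enum_sym_idom (fun k => (x k)%:P) q%:P Hj1 Hi1 Halpha Hsigma (nz t) T1.
move/(congr1 (horner_eval 0)); rewrite !Enum_morph /= evT evC => E.
have Enum_evC y : Enum alpha q t sigma y
    = Enum alpha q t sigma (fun k => horner_eval 0 (y k)%:P).
  by apply: eq_bigr => F _; congr (_ * _ * _ * _); apply: eq_bigr => u _; rewrite evC.
by rewrite Enum_evC E -Enum_evC.
Qed.

Theorem mainTheorem8 (R : fieldType) (n : nat) (alpha : 'I_n -> nat)
    (sigma : 'S_n) (j j1 i i1 : 'I_n)
    (Hj1 : val j1 = (val j).+1) (Hi1 : val i1 = (val i).+1)
    (Halpha : alpha j = alpha j1)
    (Hsigma : [set sigma j; sigma j1] = [set i; i1])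
    (x : 'I_n -> R) (q t : R)
    (Hden : forall (r : 'I_n) (c : nat), (0 < c)%N -> (c <= alpha r)%N ->
       1 - q ^+ (leg alpha r c).+1 * t ^+ (arm alpha r c).+1 != 0) :
  Eperm alpha sigma x q t = Eperm alpha sigma (fun k => x (tperm i i1 k)) q t.
Proof.
rewrite !Eperm_Enum //; congr (_ / _).
exact: Enum_sym Hj1 Hi1 Halpha Hsigma.
Qed.
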